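(* Let $B$ and $B'$ be bigraphs on the same finite node set with $\mathbf d(B)=\mathbf d(B')$. Then there is a finite sequence of $\Gamma$-, $\Sigma$-, $\Lambda$-, and $\Delta$-operations that transforms $B$ into $B'$.
   Context: A bidirected graph (bigraph) is a pair $B=(G,\tau)$ where $G=(V,E)$ is a finite simple undirected graph (no loops, no parallel edges) and $\tau:V\times E\to\{-1,0,1\}$ satisfies $\tau(v,e)\in\{-1,1\}$ if $v$ is incident to $e$ and $\tau(v,e)=0$ otherwise. Its net-degree sequence is $\mathbf d(B)\in\mathbb Z^V$, $\mathbf d(B)_v=\sum_{e\in E}\tau(v,e)$. Operations on a bigraph (all local orientations not mentioned are unchanged): $\Gamma$-operation: for two edges $uv,vw$ sharing the node $v$ with $\tau(v,uv)\ne\tau(v,vw)$, swap the values $\tau(v,uv)$ and $\tau(v,vw)$. $\Sigma$-operation: for four distinct nodes $u,v,w,x$ with $uv,wx\in E$ and $uw,vx\notin E$, replace the edges $uv,wx$ by $uw,vx$, where each node keeps its local orientation: the new $\tau(u,uw)$, $\tau(v,vx)$, $\tau(w,uw)$, $\tau(x,vx)$ equal the old $\tau(u,uv)$, $\tau(v,uv)$, $\tau(w,wx)$, $\tau(x,wx)$, respectively. $\Lambda$-operation: for an edge $uw$ and a node $v\notin\{u,w\}$ adjacent to neither $u$ nor $w$, replace $uw$ by the two edges $uv,vw$, with $\tau(u,uv)$ and $\tau(w,vw)$ equal to the old $\tau(u,uw)$ and $\tau(w,uw)$, and $\tau(v,uv)=-\tau(v,vw)=1$ (the roles of $u$ and $w$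 may be interchanged); the inverse operation is also called a $\Lambda$-operation. $\Delta$-operation: for three distinct nodes $u_1,u_2,u_3$ that are pairwise adjacent and such that at each $u_i$ the two triangle edges have opposite local orientations (i.e. $\tau(u_i,u_iu_j)\ne\tau(u_i,u_iu_k)$ for $\{i,j,k\}=\{1,2,3\}$), delete the three edges of the triangle; the inverse operation (adding such a bidirected triangle on three pairwise non-adjacent nodes) is also called a $\Delta$-operation. *)

(* Defs.v *)
From Stdlib Require Import Relation_Operators.
From HB Require Import structures.
From mathcomp Require Import all_boot all_order all_algebra.

Set Implicit Arguments.
Unset Strict Implicit.
Unset Printing Implicit Defensive.

Import Order.TTheory GRing.Theory Num.Theory.
Local Open Scope ring_scope.

(* An edge between u and v is the two-element set [set u; v], so the graph is
   simple and undirected by construction.  The function tau is defined on all of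
   V * {set V}; being forced to vanish outside the edge set, it carries no
   more information than a function on V * E, and equality of bigraphs is
   equality of the edge sets and of the local orientations. *)
Record bigraph (V : finType) := Bigraph {
  edges : {set {set V}};
  tau : {ffun V * {set V} -> int};
  edges_card2 : [forall e in edges, #|e| == 2%N];
  tau_incidence : [forall v, forall e,
    if (e \in edges) && (v \in e) then (tau (v, e) == 1) || (tau (v, e) == -1)
    else tau (v, e) == 0]
}.

Definition net_degree (V : finType) (B : bigraph V) : {ffun V -> int} :=
  [ffun v => \sum_(e in edges B) tau B (v, e)].

Definition common_tau (V : finType) (B B' : bigraph V) : Prop :=
  forall (x : V) (e : {set V}),
    e \in edges B -> e \in edges B' -> tau B' (x, e) = tau B (x, e).

Definition gamma_op (V : finType) (B B' : bigraph V) : Prop :=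
  exists u v w : V,
    [/\ u != w, [set u; v] \in edges B, [set v; w] \in edges B
      & tau B (v, [set u; v]) != tau B (v, [set v; w])] /\
    [/\ edges B' = edges B,
        tau B' (v, [set u; v]) = tau B (v, [set v; w]),
        tau B' (v, [set v; w]) = tau B (v, [set u; v])
      & forall (x : V) (e : {set V}),
          (x, e) != (v, [set u; v]) -> (x, e) != (v, [set v; w]) ->
          tau B' (x, e) = tau B (x, e)].

Definition sigma_op (V : finType) (B B' : bigraph V) : Prop :=
  exists u v w x : V,
    [/\ uniq [:: u; v; w; x],
        [set u; v] \in edges B, [set w; x] \in edges B,
        [set u; w] \notin edges B & [set v; x] \notin edges B] /\
    edges B' = [set u; w] |: ([set v; x] |:
                 (edges B :\: [set [set u; v]; [set w; x]])) /\
    [/\ tau B' (u, [set u; w]) = tau B (u, [set u; v]),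
        tau B' (v, [set v; x]) = tau B (v, [set u; v]),
        tau B' (w, [set u; w]) = tau B (w, [set w; x]),
        tau B' (x, [set v; x]) = tau B (x, [set w; x])
      & common_tau B B'].

(* As [set u; w] = [set w; u], quantifying over u and w covers both
   choices of which new edge gets the value 1 at v. *)
Definition lambda_fwd (V : finType) (B B' : bigraph V) : Prop :=
  exists u v w : V,
    [/\ uniq [:: u; v; w], [set u; w] \in edges B,
        [set u; v] \notin edges B & [set v; w] \notin edges B] /\
    edges B' = [set u; v] |: ([set v; w] |: (edges B :\ [set u; w])) /\
    [/\ tau B' (u, [set u; v]) = tau B (u, [set u; w]),
        tau B' (w, [set v; w]) = tau B (w, [set u; w]),
        tau B' (v, [set u; v]) = 1,
        tau B' (v, [set v; w]) = -1
      & common_tau B B'].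

Definition lambda_op (V : finType) (B B' : bigraph V) : Prop :=
  lambda_fwd B B' \/ lambda_fwd B' B.

Definition delta_fwd (V : finType) (B B' : bigraph V) : Prop :=
  exists u v w : V,
    [/\ uniq [:: u; v; w], [set u; v] \in edges B,
        [set u; w] \in edges B & [set v; w] \in edges B] /\
    [/\ tau B (u, [set u; v]) != tau B (u, [set u; w]),
        tau B (v, [set u; v]) != tau B (v, [set v; w])
      & tau B (w, [set u; w]) != tau B (w, [set v; w])] /\
    edges B' = edges B :\: [set [set u; v]; [set u; w]; [set v; w]] /\
    common_tau B B'.

Definition delta_op (V : finType) (B B' : bigraph V) : Prop :=
  delta_fwd B B' \/ delta_fwd B' B.

Definition bigraph_op (V : finType) (B B' : bigraph V) : Prop :=
  [\/ gamma_op B B', sigma_op B B', lambda_op B B' | delta_op B B'].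

Definition transformable (V : finType) : bigraph V -> bigraph V -> Prop :=
  clos_refl_trans (bigraph V) (@bigraph_op V).

(* Main.v *)
(** Adding edges by a Λ- or Δ-operation is never obstructed by the orientation:
    if two distinct non-neighbours [x], [y] of [v] are adjacent, the edge [xy]
    can be rerouted through [v]; if they are not adjacent, a bidirected triangle
    can be added.  Hence every bigraph can be enlarged until the complement of
    its graph is a matching.  The parity of the net-degrees determines which
    nodes are matched, so the bigraphs obtained from [B] and [B'] have
    complementary matchings covering the same nodes; Σ-operations turn one
    matching into the other, and Γ-operations then adjust the orientation. *)
Require Import Defs.
From Stdlib Require Import Relation_Operators.
From mathcomp Require Import all_boot all_order all_algebra.
From mathcomp Require Import zify.

Set Implicit Arguments.
Unset Strict Implicit.
Unset Printing Implicit Defensive.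

Import Order.TTheory GRing.Theory Num.Theory.
Local Open Scope ring_scope.

Section Bigraphs.
Variable V : finType.
Implicit Types (B T : bigraph V) (E : {set {set V}}) (e f : {set V}).

(** * Edges as pairs, and the values of the local orientation *)

Lemma eq_set2 (a b c d : V) :
  ([set a; b] == [set c; d]) =
  (a == c) && (b == d) || (a == d) && (b == c).
Proof.
apply/eqP/orP => [eq_ab | [] /andP[/eqP-> /eqP->] //]; last exact: setUC.
have := set21 a b; have := set22 a b; have := set21 c d; have := set22 c d.
rewrite {1 2}eq_ab -{1 2}eq_ab !inE.
by do 4![case/orP => /eqP ?]; subst; rewrite ?eqxx; auto.
Qed.

Lemma bigraph_eq B B' : edges B = edges B' -> tau B = tau B' -> B = B'.
Proof.
case: B B' => [E t p q] [E' t' p' q'] /= eqE eqt; subst.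
by congr Bigraph; exact: bool_irrelevance.
Qed.

Lemma edge_pair B e (v : V) :
  e \in edges B -> v \in e -> exists2 u, u != v & e = [set u; v].
Proof.
move/forallP/(_ e)/implyP: (edges_card2 B) => /[apply] /cards2P[a [b [nab ->]]].
rewrite !inE => /orP[]/eqP->; last by exists a.
by exists b; rewrite 1?eq_sym // setUC.
Qed.

Lemma loopN B (v : V) : ([set v; v] \in edges B) = false.
Proof.
apply/negbTE/negP => vvB; have [u uv /eqP] := edge_pair vvB (set21 v v).
by rewrite eq_set2 eqxx andbT orbb eq_sym (negPf uv).
Qed.

(** Shaped as a rewriting rule: after it, case splits leave only the values 1, -1 and 0. *)
Lemma tau_sign B (v : V) e :
  tau B (v, e) =
  if (e \in edges B) && (v \in e) then if tau B (v, e) == 1 then 1 else -1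
  else 0.
Proof.
move/forallP/(_ v)/forallP/(_ e): (tau_incidence B).
case: ifP => _; last by move/eqP.
by case: eqP => //= _ /eqP.
Qed.

Lemma tau_notin B (v : V) e : v \notin e -> tau B (v, e) = 0.
Proof. by move=> /negPf ve; rewrite tau_sign ve andbF. Qed.

(** * Bigraphs built from an edge set and a choice of signs *)

Section Orient.
Variables (E : {set {set V}}) (pos : V -> {set V} -> bool).
Hypothesis E2 : {in E, forall e, #|e| == 2%N}.

(** Signs are given by the Boolean [pos], so the incidence condition holds by construction. *)
Definition orient_tau : {ffun V * {set V} -> int} :=
  [ffun p => if (p.2 \in E) && (p.1 \in p.2)
             then if pos p.1 p.2 then 1 else -1 else 0].

Fact orient_card2 : [forall e in E, #|e| == 2%N].
Proof. by apply/forallP => e; apply/implyP/E2. Qed.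

Fact orient_incidence :
  [forall v, forall e, if (e \in E) && (v \in e)
     then (orient_tau (v, e) == 1) || (orient_tau (v, e) == -1)
     else orient_tau (v, e) == 0].
Proof.
apply/forallP => v; apply/forallP => e; rewrite /orient_tau ffunE /=.
by case: ifP => ->; case: (pos v e).
Qed.

Definition orient : bigraph V := Bigraph orient_card2 orient_incidence.

Lemma tau_orient (v : V) e :
  tau orient (v, e) =
  if (e \in E) && (v \in e) then if pos v e then 1 else -1 else 0.
Proof. by rewrite ffunE. Qed.
End Orient.

Lemma edge_card2 B : {in edges B, forall e, #|e| == 2%N}.
Proof. by move=> e; move/forallP/(_ e)/implyP: (edges_card2 B); apply. Qed.

(** Surviving edges keep their orientation and only new edges read [pos]; this produces the results
    of Λ-, Δ- and Σ-operations alike. *)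
Lemma exists_extension B E (pos : V -> {set V} -> bool) :
  {in E, forall e, #|e| == 2%N} ->
  exists B', [/\ edges B' = E, common_tau B B' &
    forall v e, e \notin edges B ->
      tau B' (v, e) = if (e \in E) && (v \in e)
                      then if pos v e then 1 else -1 else 0].
Proof.
move=> E2.
exists (orient (fun v e => if e \in edges B then tau B (v, e) == 1 else pos v e) E2).
split=> // [v e eB eE | v e eB]; rewrite tau_orient ?(negPf eB) //.
by rewrite [RHS]tau_sign eB; move: eE => /= ->.
Qed.

Lemma set2_card2 E (u v : V) : u != v ->
  {in E, forall e, #|e| == 2%N} -> {in [set u; v] |: E, forall e, #|e| == 2%N}.
Proof. by move=> uv E2 e /setU1P[->|/E2//]; rewrite cards2 uv. Qed.

Lemma sub_card2 E (F : {set {set V}}) : E \subset F ->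
  {in F, forall e, #|e| == 2%N} -> {in E, forall e, #|e| == 2%N}.
Proof. by move=> /subsetP sEF F2 e /sEF /F2. Qed.

(** * The four operations, with their effect on edges and net-degrees *)

(** The values 1 and -1 at [v] cancel, while [u] and [w] carry their old sign over to a new edge;
    two edges enter and one leaves. *)
Lemma lambda_add B (u v w : V) : uniq [:: u; v; w] ->
  [set u; w] \in edges B -> [set u; v] \notin edges B ->
  [set v; w] \notin edges B ->
  exists B', [/\ lambda_fwd B B', (#|edges B| < #|edges B'|)%N
               & net_degree B' = net_degree B].
Proof.
move=> uvw uwB uvB vwB; have := uvw; rewrite /= !inE negb_or andbT.
move=> /andP[/andP[uv uw] vw].
have E2 : {in [set u; v] |: ([set v; w] |: (edges B :\ [set u; w])),
            forall e, #|e| == 2%N}.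
  by do 2![apply: set2_card2 => //]; apply: sub_card2 (@edge_card2 B); exact: subsetDl.
pose pos x e := if x == v then e == [set u; v] else tau B (x, [set u; w]) == 1.
have [B' [EB' cB' newB']] := exists_extension B pos E2.
have neq : [set u; v] != [set v; w].
  by rewrite eq_set2 (negPf uv) (negPf uw).
have tu : tau B' (u, [set u; v]) = tau B (u, [set u; w]).
  by rewrite newB' // [RHS]tau_sign /pos uwB !inE !eqxx (negPf uv).
have tw : tau B' (w, [set v; w]) = tau B (w, [set u; w]).
  by rewrite newB' // [RHS]tau_sign /pos uwB !inE !eqxx !orbT eq_sym (negPf vw).
have tv1 : tau B' (v, [set u; v]) = 1.
  by rewrite newB' // /pos !inE !eqxx !orbT.
have tv2 : tau B' (v, [set v; w]) = -1.
  by rewrite newB' // /pos eq_sym (negPf neq) !inE !eqxx !orbT.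
exists B'; split.
- by exists u, v, w; split=> //; split.
- rewrite EB' !cardsU1 !inE (negPf uvB) (negPf vwB) (negPf neq) !andbF /=.
  by rewrite (cardsD1 [set u; w] (edges B)) uwB.
apply/ffunP => x; rewrite !ffunE EB'.
rewrite !big_setU1 ?inE ?negb_or ?negb_and ?neq ?uvB ?vwB ?orbT //=.
rewrite [RHS](big_setD1 [set u; w]) //=.
rewrite (eq_bigr (fun e => tau B (x, e))); last first.
  move=> e; rewrite !inE => /andP[euw eB]; apply: cB' => //.
  by rewrite EB' !inE euw eB !orbT.
rewrite addrA; congr (_ + _).
have [-> | xu] := eqVneq x u.
  by rewrite tu (tau_sign B' u [set v; w]) !inE (negPf uv) (negPf uw) andbF addr0.
have [-> | xv] := eqVneq x v.
  by rewrite tv1 tv2 (tau_sign B v [set u; w]) !inE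
             (eq_sym v u) (negPf uv) (negPf vw) andbF.
have [-> | xw] := eqVneq x w.
  by rewrite tw (tau_sign B' w [set u; v]) !inE
             (eq_sym w) (eq_sym w) (negPf uw) (negPf vw) andbF add0r.
by rewrite !tau_notin // !inE negb_or ?xu ?xv ?xw.
Qed.

Lemma delta_add B (u v w : V) : uniq [:: u; v; w] ->
  [set u; v] \notin edges B -> [set u; w] \notin edges B ->
  [set v; w] \notin edges B ->
  exists B', [/\ delta_fwd B' B, (#|edges B| < #|edges B'|)%N
               & net_degree B' = net_degree B].
Proof.
move=> uvw uvB uwB vwB; have := uvw; rewrite /= !inE negb_or andbT.
move=> /andP[/andP[uv uw] vw].
have E2 : {in [set u; v] |: ([set u; w] |: ([set v; w] |: edges B)),
            forall e, #|e| == 2%N}.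
  by do 3![apply: set2_card2 => //]; exact: edge_card2.
(* Cyclic choice [u], [v], [w], [u]: each node is positive on the edge to its successor and negative
   on the other, so the triangle adds 0 everywhere. *)
pose pos x e := [|| (x == u) && (e == [set u; v]), (x == v) && (e == [set v; w])
                  | (x == w) && (e == [set u; w])].
have [B' [EB' cB' newB']] := exists_extension B pos E2.
have n12 : ([set u; v] == [set u; w]) = false.
  by rewrite eq_set2 (negPf vw) (negPf uw) !andbF.
have n13 : ([set u; v] == [set v; w]) = false.
  by rewrite eq_set2 (negPf uv) (negPf uw).
have n23 : ([set u; w] == [set v; w]) = false.
  by rewrite eq_set2 (negPf uv) (negPf uw).
have vu : (v == u) = false by rewrite eq_sym (negPf uv).
have wu : (w == u) = false by rewrite eq_sym (negPf uw).
have wv : (w == v) = false by rewrite eq_sym (negPf vw).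
have cEq := (inE, eqxx, n12, n13, n23, eq_sym [set v; w], eq_sym [set u; w] [set u; v],
             negPf uv, negPf uw, negPf vw, vu, wu, wv, orbT, andbF).
have t1 : tau B' (u, [set u; v]) = 1 by rewrite newB' // /pos !cEq.
have t2 : tau B' (u, [set u; w]) = -1 by rewrite newB' // /pos !cEq.
have t3 : tau B' (v, [set v; w]) = 1 by rewrite newB' // /pos !cEq.
have t4 : tau B' (v, [set u; v]) = -1 by rewrite newB' // /pos !cEq.
have t5 : tau B' (w, [set u; w]) = 1 by rewrite newB' // /pos !cEq.
have t6 : tau B' (w, [set v; w]) = -1 by rewrite newB' // /pos !cEq.
exists B'; split.
- exists u, v, w; split; first by rewrite EB' !inE !eqxx !orbT.
  split; first by rewrite t1 t2 t3 t4 t5 t6.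
  split; last by move=> x e eB' eB; rewrite cB'.
  apply/setP => e; rewrite EB' !inE.
  have [->|] := eqVneq e [set u; v]; first by rewrite (negPf uvB).
  have [->|] := eqVneq e [set u; w]; first by rewrite (negPf uwB).
  by have [->|] := eqVneq e [set v; w]; first by rewrite (negPf vwB).
- rewrite EB' !cardsU1 !inE (negPf uvB) (negPf vwB) (negPf uwB) n12 n13 n23.
  by rewrite /= !add1n ltnS -addn2 leq_addr.
apply/ffunP => x.
rewrite !ffunE EB' !big_setU1 ?inE ?negb_or ?n12 ?n13 ?n23 ?uvB ?vwB ?uwB //=.
rewrite (eq_bigr (fun e => tau B (x, e))); last first.
  by move=> e eB; apply: cB' => //; rewrite EB' !inE eB !orbT.
rewrite !addrA -[RHS]add0r; congr (_ + _).
have [-> | xu] := eqVneq x u.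
  by rewrite t1 t2 (tau_sign B' u [set v; w]) !cEq.
have [-> | xv] := eqVneq x v.
  by rewrite t3 t4 (tau_sign B' v [set u; w]) !cEq.
have [-> | xw] := eqVneq x w.
  by rewrite t5 t6 (tau_sign B' w [set u; v]) !cEq.
by rewrite !tau_notin // !inE negb_or ?xu ?xv ?xw.
Qed.

(** Each of the four nodes trades one edge for another with the same sign. *)
Lemma sigma_switch B (u v w x : V) : uniq [:: u; v; w; x] ->
  [set u; v] \in edges B -> [set w; x] \in edges B ->
  [set u; w] \notin edges B -> [set v; x] \notin edges B ->
  exists B', [/\ sigma_op B B', net_degree B' = net_degree B &
    edges B' = [set u; w] |: ([set v; x] |:
                 (edges B :\: [set [set u; v]; [set w; x]]))].
Proof.
move=> uvwx uvB wxB uwB vxB; have := uvwx; rewrite /= !inE !negb_or andbT.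
move=> /andP[/and3P[uv uw ux] /andP[/andP[vw vx] wx]].
have E2 : {in [set u; w] |: ([set v; x] |:
                (edges B :\: [set [set u; v]; [set w; x]])),
            forall e, #|e| == 2%N}.
  by do 2![apply: set2_card2 => //]; apply: sub_card2 (@edge_card2 B); exact: subsetDl.
(* Each node lies on exactly one new edge, so the sign can depend on the node alone. *)
pose pos y (e : {set V}) := if (y == u) || (y == v) then tau B (y, [set u; v]) == 1
               else tau B (y, [set w; x]) == 1.
have [B' [EB' cB' newB']] := exists_extension B pos E2.
have n12 : ([set u; w] == [set v; x]) = false.
  by rewrite eq_set2 (negPf uv) (negPf ux).
have n34 : ([set u; v] == [set w; x]) = false.
  by rewrite eq_set2 (negPf uw) (negPf ux).
have vu : (v == u) = false by rewrite eq_sym (negPf uv).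
have wu : (w == u) = false by rewrite eq_sym (negPf uw).
have wv : (w == v) = false by rewrite eq_sym (negPf vw).
have xu : (x == u) = false by rewrite eq_sym (negPf ux).
have xv : (x == v) = false by rewrite eq_sym (negPf vx).
have xw : (x == w) = false by rewrite eq_sym (negPf wx).
have cEq := (inE, eqxx, negPf uv, negPf uw, negPf ux, negPf vw, negPf vx, negPf wx,
             vu, wu, wv, xu, xv, xw, orbT, andbF).
have t1 : tau B' (u, [set u; w]) = tau B (u, [set u; v]).
  by rewrite newB' // [RHS]tau_sign /pos uvB !cEq.
have t2 : tau B' (v, [set v; x]) = tau B (v, [set u; v]).
  by rewrite newB' // [RHS]tau_sign /pos uvB !cEq.
have t3 : tau B' (w, [set u; w]) = tau B (w, [set w; x]).
  by rewrite newB' // [RHS]tau_sign /pos wxB !cEq.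
have t4 : tau B' (x, [set v; x]) = tau B (x, [set w; x]).
  by rewrite newB' // [RHS]tau_sign /pos wxB !cEq.
exists B'; split=> //; first by exists u, v, w, x.
apply/ffunP => y.
rewrite !ffunE EB' !big_setU1 ?inE ?negb_or ?negb_and ?n12 ?uwB ?vxB ?orbT //=.
rewrite [RHS](big_setD1 [set u; v]) //=.
rewrite [X in _ = _ + X](big_setD1 [set w; x]) /=; last first.
  by rewrite !inE (eq_sym [set w; x]) n34 wxB.
rewrite setDDl (eq_bigr (fun e => tau B (y, e))); last first.
  move=> e eE; apply: cB'; last by rewrite EB' 2!in_setU eE !orbT.
  by case/setDP: eE.
rewrite !addrA; congr (_ + _).
have [-> | yu] := eqVneq y u.
  by rewrite t1 (tau_sign B' u [set v; x]) (tau_sign B u [set w; x]) !cEq.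
have [-> | yv] := eqVneq y v.
  by rewrite t2 (tau_sign B' v [set u; w]) (tau_sign B v [set w; x]) !cEq ?add0r ?addr0.
have [-> | yw] := eqVneq y w.
  by rewrite t3 (tau_sign B' w [set v; x]) (tau_sign B w [set u; v]) !cEq ?add0r ?addr0.
have [-> | yx] := eqVneq y x.
  by rewrite t4 (tau_sign B' x [set u; w]) (tau_sign B x [set u; v]) !cEq.
by rewrite !tau_notin // !inE negb_or ?yu ?yv ?yw ?yx.
Qed.

(** Naming the edges rather than their far ends suits the sign argument below; the sum at [v] only
    has two terms exchanged. *)
Lemma gamma_swap B (v : V) e f : e \in edges B -> f \in edges B ->
  v \in e -> v \in f -> tau B (v, e) != tau B (v, f) ->
  exists B', [/\ gamma_op B B', edges B' = edges B, net_degree B' = net_degree B &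
    [/\ tau B' (v, e) = tau B (v, f), tau B' (v, f) = tau B (v, e) &
      forall p, p != (v, e) -> p != (v, f) -> tau B' p = tau B p]].
Proof.
move=> eB fB ve vf nt.
have nef : e != f by apply: contraNneq nt => ->.
pose pos x g := if x == v then
    if g == e then tau B (v, f) == 1 else
    if g == f then tau B (v, e) == 1 else tau B (x, g) == 1
  else tau B (x, g) == 1.
pose B' := orient pos (@edge_card2 B).
have te : tau B' (v, e) = tau B (v, f).
  by rewrite tau_orient [RHS]tau_sign eB fB ve vf /pos !eqxx.
have tf : tau B' (v, f) = tau B (v, e).
  by rewrite tau_orient [RHS]tau_sign eB fB ve vf /pos !eqxx eq_sym (negPf nef).
have tother p : p != (v, e) -> p != (v, f) -> tau B' p = tau B p.
  case: p => x g; rewrite tau_orient [RHS]tau_sign /pos !xpair_eqE.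
  by case: (x == v) => //= /negPf-> /negPf->.
exists B'; split=> //.
  have [u uv def_e] := edge_pair eB ve; have [w wv def_f] := edge_pair fB vf.
  rewrite setUC in def_f; exists u, v, w; rewrite -def_e -def_f.
  split; split=> //; last by move=> x g; apply: tother.
  by apply: contraNneq nef => uw; rewrite def_e def_f uw setUC.
apply/ffunP => x; rewrite !ffunE (big_setD1 e) // [RHS](big_setD1 e) //=.
have fe : f \in edges B :\ e by rewrite !inE eq_sym nef.
rewrite (big_setD1 f) // [X in _ = _ + X](big_setD1 f) //= !addrA; congr (_ + _).
  have [-> | xv] := eqVneq x v; first by rewrite te tf addrC.
  by rewrite !tother // xpair_eqE (negPf xv).
apply: eq_bigr => g; rewrite !inE => /and3P[gf ge gB].
by rewrite tother // xpair_eqE negb_and ?gf ?ge orbT.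
Qed.

(** * Bigraphs with a common edge set *)

(** Induction on the number of incidences where the orientations disagree; one Γ-operation removes
    two of them. *)
Lemma same_edges_transformable B B' :
  edges B = edges B' -> net_degree B = net_degree B' -> transformable B B'.
Proof.
have [n] := ubnP #|[set p | tau B p != tau B' p]|.
elim: n B => // n IHn B leBn eqE eqd.
have [eqt | [p]] := set_0Vmem [set p | tau B p != tau B' p].
  rewrite (bigraph_eq eqE (B' := B')); first exact: rt_refl.
  by apply/ffunP => p; apply/eqP; have /setP/(_ p) := eqt; rewrite !inE => /negbFE.
case: p => v e; rewrite inE => nt.
have /andP[eB ve] : (e \in edges B) && (v \in e).
  by apply: contraNT nt => /negPf nve; rewrite tau_sign (tau_sign B') -eqE nve.
(* The differences [tau B (v, g) - tau B' (v, g)] sum to 0, so some [f] has a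
   difference of the sign opposite to that of [e]. *)
have [f [fB vf ntf ntef]] : exists f, [/\ f \in edges B, v \in f,
    tau B (v, f) != tau B' (v, f) & tau B (v, e) != tau B (v, f)].
  have /eqP := congr1 (fun d : {ffun V -> int} => d v) eqd.
  rewrite !ffunE -eqE -subr_eq0 -sumrB (big_setD1 e) //= => sum0.
  have [/existsP[f] | /existsPn same] := boolP [exists f,
    [&& f \in edges B, v \in f, tau B (v, f) != tau B' (v, f)
      & tau B (v, e) != tau B (v, f)]].
    by case/and4P; exists f.
  (* The factor [tau B (v, e)] normalises signs: without a suitable [f] no term is negative, yet the
     term of [e] is 2. *)
  have sumP (g : {set V}) : g \in edges B :\ e ->
    0 <= (tau B (v, g) - tau B' (v, g)) * tau B (v, e).
    rewrite !inE => /andP[ge gB]; have := same g; rewrite gB /=.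
    rewrite (tau_sign B v g) (tau_sign B' v g) -eqE gB /=.
    rewrite (tau_sign B v e) eB ve /=.
    by case: (v \in g) => //=; do 3?case: ifP => _.
  have : 0 <= \sum_(g in edges B :\ e)
      (tau B (v, g) - tau B' (v, g)) * tau B (v, e) by exact: sumr_ge0.
  rewrite -mulr_suml; move: (\sum_(g in _) _) sum0 nt => S.
  rewrite (tau_sign B v e) (tau_sign B' v e) -eqE eB ve /=.
  by do 2!case: ifP => _; lia.
have [B1 [gB EB1 dB1 [te tf tother]]] := gamma_swap eB fB ve vf ntef.
apply: rt_trans (IHn B1 _ _ _); rewrite ?EB1 ?dB1 //.
  by apply: rt_step; apply: Or41.
rewrite ltnS in leBn; apply: leq_trans leBn; apply: proper_card.
(* With only two signs available, each edge holds the value that [B'] has at the other, so the swap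
   repairs both. *)
have [tfe tef] : tau B (v, f) = tau B' (v, e) /\ tau B (v, e) = tau B' (v, f).
  move: nt ntf ntef; rewrite (tau_sign B v e) (tau_sign B v f).
  rewrite (tau_sign B' v e) (tau_sign B' v f) -eqE eB fB ve vf /=.
  by do 4!case: ifP => _.
apply/properP; split; last by exists (v, e); rewrite !inE // te tfe eqxx.
apply/subsetP => p; rewrite !inE.
have [-> | pe] := eqVneq p (v, e); first by rewrite te tfe eqxx.
have [-> | pf] := eqVneq p (v, f); first by rewrite tf tef eqxx.
by rewrite tother.
Qed.

(** * Enlarging a bigraph until its complement is a matching *)

(** The complement graph has maximum degree at most 1. The case of [v] itself is excluded because a
    loop is never an edge. *)
Definition comatching E := forall v x y : V, x != v -> y != v ->
  [set v; x] \notin E -> [set v; y] \notin E -> x = y.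

(** Both directions are recorded, since the final path climbs from one bigraph and descends to the
    other; Λ and Δ include their inverses. *)
Lemma exists_comatching B : exists T, [/\ transformable B T, transformable T B,
  net_degree T = net_degree B & comatching (edges T)].
Proof.
(* Any uniform bound on edge sets makes [N - #|edges B|] a measure that drops when edges are
   added. *)
have [N leN] : exists N : nat, forall E, (#|E| <= N)%N.
  by exists #|{: {set V}}| => E; exact: max_card.
have [n] := ubnP (N - #|edges B|).
elim: n B => // n IHn B leBn.
suff [|[B' [BB' B'B ltB dB]]] : comatching (edges B) \/
    exists B', [/\ bigraph_op B B', bigraph_op B' B,
      (#|edges B| < #|edges B'|)%N & net_degree B' = net_degree B].
- by exists B; split=> //; exact: rt_refl.
- have [|T [B'T TB' dT cT]] := IHn B'.
    by have := leN (edges B'); lia.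
  exists T; split=> //; last by rewrite dT.
    by apply: rt_trans B'T; apply: rt_step.
  by apply: rt_trans TB' _; apply: rt_step.
have [/existsP[v /existsP[x /existsP[y]]] | none] := boolP [exists v : V,
  [exists x : V, [exists y : V, [&& x != v, y != v, [set v; x] \notin edges B,
    [set v; y] \notin edges B & x != y]]]].
  case/and5P => xv yv vxB vyB xy; right.
  have uniq_xvy : uniq [:: x; v; y] by rewrite /= !inE negb_or xv xy eq_sym yv.
  rewrite setUC in vxB.
  have [xyB | xyB] := boolP ([set x; y] \in edges B).
    have [B' [lB ltB dB]] := lambda_add uniq_xvy xyB vxB vyB.
    by exists B'; split=> //; apply: Or43; [left | right].
  have [B' [lB ltB dB]] := delta_add uniq_xvy vxB xyB vyB.
  by exists B'; split=> //; apply: Or44; [right | left].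
left=> v x y xv yv vxB vyB; apply/eqP; apply: contraNT none => xy.
by apply/existsP; exists v; apply/existsP; exists x; apply/existsP; exists y; apply/and5P.
Qed.

(** * Parity of the net-degrees *)

Lemma net_degree_neighbors B (v : V) :
  net_degree B v = \sum_(w : V) tau B (v, [set v; w]).
Proof.
rewrite ffunE.
rewrite -(big_imset (fun e => tau B (v, e)) (h := fun w => [set v; w])) /=; last first.
  move=> w w' _ _ /eqP; rewrite eq_set2 eqxx /=.
  by case/orP=> [/eqP// | /andP[/eqP <- /eqP]].
rewrite [LHS](big_setID ((fun w => [set v; w]) @: V)) /=.
rewrite [RHS](big_setID (edges B)) /= setIC; congr (_ + _).
rewrite !big1 // => e; rewrite inE => /andP[eV eB]; rewrite tau_sign.
  by rewrite (negPf eV).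
rewrite eB; case: ifP => // ve; case/imsetP: eV.
by have [u _ ->] := edge_pair eB ve; exists u => //; rewrite setUC.
Qed.

(** A value of 1 or -1 at an incident edge is twice the indicator of being 1, minus 1; thus [m]
    counts the positive edges at [v]. *)
Lemma degree_parity B (v : V) :
  exists m : nat, net_degree B v = (m.*2)%:Z - #|[set w | [set v; w] \in edges B]|%:Z.
Proof.
exists (\sum_(w : V) (tau B (v, [set v; w]) == 1)%R)%N.
have posz_sum (F : V -> nat) : (\sum_w F w)%N%:Z = \sum_w (F w)%:Z.
  by rewrite -natz natr_sum; apply: eq_bigr => w _; rewrite natz.
have -> : #|[set w | [set v; w] \in edges B]| =
          (\sum_w ([set v; w] \in edges B))%N.
  by rewrite -sum1dep_card big_mkcond; apply: eq_bigr => w _; case: (_ \in _).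
rewrite net_degree_neighbors -mul2n big_distrr /= !posz_sum -sumrB.
apply: eq_bigr => w _; rewrite (tau_sign B) !inE eqxx andbT.
by case: ([set v; w] \in edges B); case: (tau B (v, [set v; w]) == 1).
Qed.

(** Here [v] has [#|V| - 2] neighbours in [T]; if it were adjacent to all other nodes in [T'], it
    would have [#|V| - 1] there, of the other parity. *)
Lemma comatching_uncovered T T' (v x : V) :
  net_degree T = net_degree T' -> comatching (edges T) ->
  x != v -> [set v; x] \notin edges T ->
  exists2 y, y != v & [set v; y] \notin edges T'.
Proof.
move=> eqd cT xv vxT; apply/exists_inP; apply: contraT => /exists_inPn full.
have [m dT] := degree_parity T v; have [m' dT'] := degree_parity T' v.
have NT : [set w | [set v; w] \in edges T] = ~: [set v; x].
  apply/setP => w; rewrite !inE; have [->|wv] := eqVneq w v; first by rewrite loopN.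
  have [->|wx] := eqVneq w x; first by rewrite (negPf vxT).
  by apply: contraNT wx => vwT; apply/eqP/(cT v).
have NT' : [set w | [set v; w] \in edges T'] = ~: [set v].
  apply/setP => w; rewrite !inE; have [->|wv] := eqVneq w v; first by rewrite loopN.
  by have := full w wv; rewrite negbK => ->.
have := cardsC [set v; x]; have := cardsC [set v]; rewrite cards1 cards2 eq_sym xv.
by move: dT dT'; rewrite eqd NT NT'; lia.
Qed.

(** * Switching one complementary matching into another *)

(** Induction on the number of edges of [T'] missing from [T]; once none is missing, the edge sets
    agree and only orientations remain. *)
Lemma comatching_transformable T T' : net_degree T = net_degree T' ->
  comatching (edges T) -> comatching (edges T') -> transformable T T'.
Proof.
have [n] := ubnP #|edges T' :\: edges T|.
elim: n T => // n IHn T leTn eqd cT cT'.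
have [sT'T | /subsetPn[e eT' eT]] := boolP (edges T' \subset edges T).
  apply: same_edges_transformable => //; apply/eqP; rewrite eqEsubset sT'T andbT.
  apply/subsetP => e eT; have /cards2P[a [c [ac def_e]]] := edge_card2 eT.
  (* If [ac] is missing from [T'], parity gives some [ab] missing from [T], hence from [T']; the
     matching property forces [b = c]. *)
  rewrite def_e in eT *; apply: contraLR eT => acT'.
  rewrite eq_sym in ac.
  have [b ba abT] := comatching_uncovered (esym eqd) cT' ac acT'.
  rewrite (cT' a c b) //; by apply: contraNN abT => /(subsetP sT'T).
(* In the complement of [T], [a] is matched to [b] and [c] to [d], while in the
   complement of [T'], [a] is matched to [c]: the switch from [ac], [bd] to
   [ab], [cd] improves the agreement with [T']. *)
have /cards2P[a [b [ab def_e]]] := edge_card2 eT'; rewrite {e}def_e in eT eT'.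
have ba : b != a by rewrite eq_sym.
have [c ca acT'] := comatching_uncovered eqd cT ba eT.
have bc : b != c by apply: contraNneq acT' => <-.
have ac : a != c by rewrite eq_sym.
have acT : [set a; c] \in edges T.
  by apply: contraNT bc => acT; apply/eqP/(cT a).
have caT' : [set c; a] \notin edges T' by rewrite setUC.
have [d dc cdT] := comatching_uncovered (esym eqd) cT' ac caT'.
have da : d != a by apply: contraNneq cdT => ->; rewrite setUC.
have baT : [set b; a] \notin edges T by rewrite setUC.
have cb : c != b by rewrite eq_sym.
have bcT : [set b; c] \in edges T.
  by apply: contraNT ac => bcT; apply/eqP/(cT b).
have db : d != b by apply: contraNneq cdT => ->; rewrite setUC.
have bdT : [set b; d] \in edges T.
  by apply: contraNT da => bdT; rewrite eq_sym; apply/eqP/(cT b).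
have cdT' : [set c; d] \in edges T'.
  by apply: contraNT da => cdT'; rewrite eq_sym; apply/eqP/(cT' c).
have uniq_acbd : uniq [:: a; c; b; d].
  by rewrite /= !inE !negb_or ac ab cb /= !(eq_sym _ d) da dc db.
have [T1 [sT1 dT1 ET1]] := sigma_switch uniq_acbd acT bdT eT cdT.
have nabcd : [set a; b] != [set c; d].
  by rewrite eq_set2 (negPf ac) (eq_sym a) (negPf da).
apply: rt_trans (IHn T1 _ _ _ _) => //; first by apply: rt_step; apply: Or42.
(* The measure drops: [ab] and [cd] are gained, and of the two edges lost only [bd] can belong to
   [T']. *)
- have sub : edges T' :\: edges T1 \subset
      [set b; d] |: (((edges T' :\: edges T) :\ [set a; b]) :\ [set c; d]).
    apply/subsetP => e; rewrite ET1 !inE.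
    have [//|_ /=] := eqVneq e [set b; d].
    have [->|_ /=] := eqVneq e [set a; c]; first by rewrite (negPf acT') andbF.
    by rewrite !negb_or -!andbA => /and4P[-> -> -> ->].
  move/subset_leq_card: sub; rewrite cardsU1 => sub.
  have {}sub := leq_trans sub (leq_add (leq_b1 _) (leqnn _)).
  move: leTn; rewrite (cardsD1 [set a; b]) !inE eT eT' /=.
  rewrite (cardsD1 [set c; d]) !inE cdT cdT' (eq_sym [set c; d]) nabcd /=.
  by rewrite !add1n ltnS; apply: leq_ltn_trans.
- by rewrite dT1.
have nonedge (p q : V) : [set p; q] \notin edges T1 ->
    [set p; q] \notin edges T \/
    [set p; q] = [set a; c] \/ [set p; q] = [set b; d].
  rewrite ET1 !inE.
  have [-> | _] := eqVneq [set p; q] [set a; c]; first by right; left.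
  have [-> | _] := eqVneq [set p; q] [set b; d]; first by right; right.
  by case: (_ \in edges T); [rewrite !orbT | left].
have abT1 : [set a; b] \in edges T1 by rewrite ET1 !inE eqxx.
have cdT1 : [set c; d] \in edges T1 by rewrite ET1 !inE eqxx orbT.
(* The complement of [T] matches [a], [b], [c], [d] only along [ab] and [cd], which are now edges;
   surviving non-edges therefore avoid these four nodes. *)
have old_nonedge p q : q != p -> [set p; q] \notin edges T ->
    [set p; q] \notin edges T1 -> p \notin [:: a; b; c; d].
  move=> qp pqT; apply: contra; rewrite !inE => /or4P[]/eqP def_p; subst p.
  - by rewrite (cT a q b).
  - by rewrite (cT b q a) // setUC.
  - by rewrite (cT c q d).
  - by rewrite (cT d q c) // 1?setUC // eq_sym.
move=> p q r qp rp pqT1 prT1.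
have new_nonedge s : [set p; s] = [set a; c] \/ [set p; s] = [set b; d] ->
    p \in [:: a; b; c; d].
  move=> ps; rewrite !inE.
  by case: ps => /eqP; rewrite eq_set2 => /orP[]/andP[-> _]; rewrite ?orbT.
have [pqT | pq] := nonedge _ _ pqT1.
  have [prT | /new_nonedge pabcd] := nonedge _ _ prT1; first exact: cT pqT prT.
  by have := old_nonedge p q qp pqT pqT1; rewrite pabcd.
have [prT | pr] := nonedge _ _ prT1.
  by have := old_nonedge p r rp prT prT1; rewrite (new_nonedge q pq).
have ad : a != d by rewrite eq_sym.
have cd : c != d by rewrite eq_sym.
have bd : b != d by rewrite eq_sym.
(* Both non-edges at [p] are new; as [ac] and [bd] are disjoint, they coincide. *)
by move: pr; case: pq => /eqP; rewrite eq_set2 => /orP[]/andP[/eqP-> /eqP->];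
  case=> /eqP; rewrite eq_set2 ?eqxx ?(negPf ab) ?(negPf ba) ?(negPf ac)
    ?(negPf ca) ?(negPf ad) ?(negPf da) ?(negPf bc) ?(negPf cb) ?(negPf bd)
    ?(negPf db) ?(negPf cd) ?(negPf dc) ?orbF //= => /eqP->.
Qed.

End Bigraphs.

Theorem theorem4p7 (V : finType) (B B' : bigraph V)
  (hd : net_degree B = net_degree B') : transformable B B'.
Proof.
have [T [BT _ dT cT]] := exists_comatching B.
have [T' [_ TB' dT' cT']] := exists_comatching B'.
apply: rt_trans BT (rt_trans _ _ _ _ _ _ TB').
by apply: comatching_transformable; rewrite // dT hd.
Qed.
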